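(* Let $\mathfrak g=\mathfrak{gl}_n$ over $\mathbb C$, let $A=\operatorname{diag}(\lambda_1,\ldots,\lambda_n)$ with $\lambda_i\ne\lambda_j$ for $i\neq j$, let $N=L_A:x\mapsto Ax$, and identify $\mathfrak g^*$ with $\mathfrak g$ by means of the form $\operatorname{Tr}(XY)$. Let $h_{kl}$ be the coefficient of $\lambda^l$ in $\frac1k\operatorname{Tr}(x+\lambda A)^k$, and let $f_{kl}$ be the coefficient of $1/\lambda^l$ in $\operatorname{Tr}\bigl(\sum_{j=0}^\infty \lambda^{-j}N^jx\bigr)^k$. Then the functions $h_{kl}$, $k=1,\ldots,n$, $l=0,\ldots,k-1$, and the functions $f_{kl}$, $k=1,\ldots,n$, $l=0,\ldots,k-1$, functionally generate the same families of functions in involution.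
   Context: The functions $h_{kl}$ and $f_{kl}$ are polynomial functions of $x\in\mathfrak g\simeq\mathfrak g^*$; $N^jx=A^jx$, and $\operatorname{Tr}(Y)^k$ means $\operatorname{Tr}(Y^k)$. Two finite collections of functions functionally generate the same family if, near every point of some open dense set, each function of either collection can be expressed as a (holomorphic) function of the functions of the other collection. Involution is understood with respect to all bivectors of the Poisson pencil $\theta_N^s=s_1\theta_1+s_2\theta_2$, $s\in\mathbb C^2$, where $\theta_1,\theta_2$ are the Lie–Poisson structures on $\mathfrak g^*$ corresponding to the Lie brackets $[x,y]=xy-yx$ and $[x,y]_N=[Nx,y]+[x,Ny]-N[x,y]=xAy-yAx$: that is, the Poisson brackets of any two functions of the family vanish for every $\theta_N^s$. *)

(* Defs.v *)
From HB Require Import structures.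
From mathcomp Require Import all_boot all_order all_algebra.
From mathcomp Require Import all_classical all_reals all_analysis.
From mathcomp Require Import complex.
Import numFieldNormedType.Exports.

Set Implicit Arguments.
Unset Strict Implicit.
Unset Printing Implicit Defensive.

Import Order.TTheory GRing.Theory Num.Theory.
Local Open Scope classical_set_scope.
Local Open Scope ring_scope.

(* The definitions below are over a numFieldType K with the topology of its   *)
(* norm. That topology is found by unification on the carrier of a            *)
(* numFieldType but not on the concrete type R[i], hence this packaging of    *)
(* the field of complex numbers.                                              *)
Definition complexField (R : realType) : numFieldType := R[i]%C.

Section FormalSeries.
Context {T : pzSemiRingType}.

(* The sequence a stands for \sum_j a_j lambda^(-j). *)
Definition fps_one : nat -> T := fun l => (l == 0%N)%:R.

Definition fps_mul (a b : nat -> T) : nat -> T :=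
  fun l => \sum_(i < l.+1) a i * b (l - i)%N.

Definition fps_exp (a : nat -> T) (k : nat) : nat -> T :=
  iter k (fps_mul a) fps_one.

End FormalSeries.

Section TwoFamilies.
Context {K : numFieldType} {n : nat}.
Implicit Types (A x : 'M[K]_n).

Definition left_mul A : 'M[K]_n -> 'M[K]_n := fun x => A *m x.

Definition h_fun A (k l : nat) : 'M[K]_n -> K := fun x =>
  (k%:R^-1 *: \tr ((map_mx polyC x + 'X *: map_mx polyC A) ^+ k))`_l.

Definition f_fun A (k l : nat) : 'M[K]_n -> K := fun x =>
  \tr (fps_exp (fun j => iter j (left_mul A) x) k l).

(* The pairs (k, l) with 1 <= k <= n and 0 <= l <= k - 1: the index           *)
(* Tagged _ l with tag k : 'I_n and l : 'I_k.+1 stands for the pair (k+1, l). *)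
Definition kl_index := {k : 'I_n & 'I_k.+1}.

Definition h_family A (i : kl_index) : 'M[K]_n -> K :=
  h_fun A (tag i).+1 (tagged i).

Definition f_family A (i : kl_index) : 'M[K]_n -> K :=
  f_fun A (tag i).+1 (tagged i).

End TwoFamilies.

Section FunctionalGeneration.
Context {K : numFieldType} {n : nat}.
Local Notation M := 'M[K]_n.

Definition family_row (I : finType) (f : I -> M -> K) (x : M) : 'rV[K]_#|I| :=
  \row_(i < #|I|) f (enum_val i) x.

(* Holomorphy in several variables is K-differentiability on an open set. *)
Definition holomorphic_on (m : nat) (V : set 'rV[K]_m) (F : 'rV[K]_m -> K) :=
  open V /\ forall y, V y -> differentiable F y.

Definition holomorphic_function_near (I : finType) (f : I -> M -> K)
    (g : M -> K) (x0 : M) :=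
  exists (U : set M) (V : set 'rV[K]_#|I|) (F : 'rV[K]_#|I| -> K),
    [/\ open U /\ U x0,
        holomorphic_on V F,
        forall x, U x -> V (family_row f x) &
        forall x, U x -> g x = F (family_row f x)].

Definition functionally_generate_same (I J : finType)
    (f : I -> M -> K) (g : J -> M -> K) :=
  exists O : set M,
    [/\ open O, dense O &
        forall x, O x ->
          (forall j, holomorphic_function_near f (g j) x) /\
          (forall i, holomorphic_function_near g (f i) x)].

End FunctionalGeneration.

Section PoissonPencil.
Context {K : numFieldType} {n : nat}.
Implicit Types (A x y : 'M[K]_n) (f g : 'M[K]_n -> K).

Definition lie_bracket x y : 'M[K]_n := x *m y - y *m x.

Definition lie_bracketN A x y : 'M[K]_n :=
  lie_bracket (left_mul A x) y + lie_bracket x (left_mul A y)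
  - left_mul A (lie_bracket x y).

Definition pencil_bracket A (s1 s2 : K) x y : 'M[K]_n :=
  s1 *: lie_bracket x y + s2 *: lie_bracketN A x y.

(* The differential of f at x, a linear form on gl_n, seen as an element of   *)
(* gl_n through the trace form: \tr (gradient f x *m v) = 'd f x v.           *)
Definition gradient f x : 'M[K]_n :=
  \matrix_(i, j) 'd f x (delta_mx j i).

(* Lie-Poisson bracket of the Lie bracket s1 [,] + s2 [,]_N, i.e. the bracket *)
(* of s1 theta_1 + s2 theta_2, at the point \tr (x *m _) of the dual of gl_n. *)
Definition poisson_bracket A (s1 s2 : K) f g : 'M[K]_n -> K := fun x =>
  \tr (x *m pencil_bracket A s1 s2 (gradient f x) (gradient g x)).

Definition in_involution A (F : set ('M[K]_n -> K)) :=
  forall s1 s2 f g, F f -> F g ->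
    forall x, poisson_bracket A s1 s2 f g x = 0.

End PoissonPencil.

(* Main.v *)
Require Import Defs.
From mathcomp Require Import all_boot all_order all_algebra zify ring.
From mathcomp Require Import all_classical all_reals all_analysis.
From mathcomp Require Import complex.

Set Implicit Arguments.
Unset Strict Implicit.
Unset Printing Implicit Defensive.

Import Order.TTheory GRing.Theory Num.Theory.
Import numFieldNormedType.Exports.
Local Open Scope classical_set_scope.
Local Open Scope ring_scope.

(** Up to constant factors, both families are finite parts of one array.  Let
  W_kl be the sum of all products of k factors x and l factors A, that is, the
  coefficient of lambda^l in (x + lambda A)^(k+l).  Differentiating
  Tr (x + lambda A)^m in lambda shows that Tr (W_(k-1,l) x) is k/(k+l) times
  Tr W_kl, and expanding the geometric series shows that f_kl is
  Tr (W_(k-1,l) x); hence f_kl = k h_(k+l,l) for all k >= 1 and l >= 0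
  ([f_fun_h_fun]).  Write F for the doubly infinite array f_kl: the h family is
  its triangle k + l <= n and the f family its triangle l < k <= n.

  Involution.  The gradient of h_(m+1,l) is the coefficient of lambda^l in
  (x + lambda A)^m, so it is enough to pair powers of Y1 = x + a A and of
  Y2 = x + b A for a <> b.  Then x and A are linear combinations of Y1 and Y2,
  and the brackets vanish because the first gradient commutes with Y1 and the
  second with Y2 ([commuting_pencil_dual]).

  Generation.  Let det (1 - t A - z x) be the sum of d_kl z^k t^l.  It has
  total degree at most n in (z, t), so d_kl = 0 for k + l > n, and d_0l does not
  depend on x.  Its logarithmic derivative in z gives Newton's identities
  ([char_coef_f_fun])
    k d_kl = - sum of d_(k-i,l-j) f_ij over 1 <= i <= k and 0 <= j <= l.
  They express d_kl through the f_ij with 1 <= i <= k and j <= l, and f_kl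
  through the d_ij with i <= k and j <= l.  Therefore the triangle k + l <= n of F
  determines all d_kl, then all of F, polynomially ([f_fun_of_triangle]).

  In the other direction one climbs the powers of t.  Once the entries of index
  smaller than l are known, the identities for t^l and k = 1, ..., n form a
  linear system in the n unknowns d_kl (1 <= k <= n - l) and f_il
  (1 <= i <= l), since the f_il with l < i <= n belong to the f family.  The
  matrix depends on x only through d_k0 and f_i0, and Cramer's rule solves the
  system wherever its determinant is non-zero ([char_coef_of_f_family]).  The
  determinant is a polynomial in x, so it is non-zero on an open dense set as
  soon as it is non-zero at one point.  An idempotent x of rank n - l is such a
  point: there det (1 - z x) = (1 - z)^(n-l), and a kernel vector would give
  polynomials p and psi vanishing at 0, of degrees at most n - l and l, with
  p = - (1 - z)^(n-l) psi modulo z^(n+1), hence exactly; comparing degrees,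
  psi = p = 0 ([level_mx_kernel]). *)

(** * Derivatives of determinants and of traces of powers *)

Lemma deriv_prod (R : comNzRingType) (I : eqType) (r : seq I)
    (p : I -> {poly R}) : uniq r ->
  (\prod_(i <- r) p i)^`() =
  \sum_(i <- r) (p i)^`() * \prod_(j <- r | j != i) p j.
Proof.
elim: r => [|a r IHr] /=; first by rewrite !big_nil derivC.
case/andP=> ar ur; rewrite !big_cons derivM IHr // eqxx /=; congr (_ * _ + _).
  rewrite [RHS]big_seq_cond [LHS]big_seq; apply: eq_bigl => i.
  by rewrite andbC; case: eqP => //= ->; rewrite (negPf ar).
rewrite mulr_sumr !big_seq; apply: eq_bigr => i ir.
rewrite big_cons; case: eqP => [ai|_] /=; last by rewrite mulrCA.
by rewrite ai ir in ar.
Qed.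

(** Jacobi's formula.  Row by row, differentiating the Leibniz expansion replaces
  one row of M by its derivative, and expanding each such determinant along
  that row produces the cofactors of M. *)
Lemma deriv_det (R : comNzRingType) n (M : 'M[{poly R}]_n) :
  (\det M)^`() = \tr (\adj M *m map_mx (@deriv R) M).
Proof.
(* N i is M with its row i differentiated. *)
pose N i := \matrix_(a, b) if a == i then (M a b)^`() else M a b.
transitivity (\sum_i \det (N i)); last first.
  rewrite mxtrace_mulC; apply: eq_bigr => i _.
  rewrite (expand_det_row _ i) mxE; apply: eq_bigr => j _; rewrite !mxE eqxx.
  congr (_ * (_ * \det _)); apply/matrixP => a b.
  by rewrite !mxE eq_sym (negPf (neq_lift _ _)).
rewrite /determinant exchange_big /= raddf_sum; apply: eq_bigr => s _.
rewrite -mulr_sumr.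
have signC (b : bool) : (-1) ^+ b = ((-1) ^+ b)%:P :> {poly R}.
  by rewrite rmorphXn rmorphN1.
rewrite !signC !mul_polyC /= derivZ deriv_prod ?index_enum_uniq //; congr (_ *: _).
apply: eq_bigr => i _; rewrite [RHS](bigD1 i) //= mxE eqxx; congr (_ * _).
by apply: eq_bigr => j /negPf ji; rewrite mxE ji.
Qed.

(** The sequence dY is any derivative of the powers of Y in the direction V: the
  formal derivative of a polynomial matrix, or a first variation.  Under the
  trace, the m + 1 terms of the product rule become equal by cyclicity. *)
Lemma trace_deriv_exp (R : comNzRingType) n (Y V : 'M[R]_n)
    (dY : nat -> 'M[R]_n) :
  dY 0%N = 0 -> (forall m, dY m.+1 = V *m Y ^+ m + Y *m dY m) ->
  forall m, \tr (dY m.+1) = m.+1%:R * \tr (Y ^+ m *m V).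
Proof.
move=> dY0 dYS.
have H m j : \tr (Y ^+ j *m dY m.+1) = m.+1%:R * \tr (Y ^+ (j + m) *m V).
  elim: m j => [|m IHm] j.
    by rewrite dYS dY0 mulmx0 addr0 expr0 mulmx1 mul1r addn0.
  rewrite dYS mulmxDr mxtraceD mulmxA mxtrace_mulC !mulmxA.
  have <- : Y ^+ j.+1 = Y ^+ j *m Y by rewrite exprSr.
  rewrite IHm addSnnS; have -> : Y ^+ m.+1 *m Y ^+ j = Y ^+ (j + m.+1).
    by rewrite addnC exprD.
  by rewrite [in RHS]mulrS mulrDl mul1r.
by move=> m; rewrite -(H m 0%N) expr0 mul1mx.
Qed.

(** * The coefficients of the powers of x + lambda A *)

Definition coef_mx (R : comNzRingType) n (l : nat) (B : 'M[{poly R}]_n) :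
    'M[R]_n :=
  \matrix_(i, j) (B i j)`_l.

(** The convention u_(-1) = 0 lets recurrences in two indices hold up to the
  boundary as a single equation. *)
Definition shift (V : zmodType) (u : nat -> V) (k : nat) : V :=
  if k is k'.+1 then u k' else 0.

Section CoefMx.
Variables (R : comNzRingType) (n : nat).
Implicit Types (x : 'M[R]_n) (B : 'M[{poly R}]_n).

Lemma coef_mx0 l : coef_mx l (0 : 'M[{poly R}]_n) = 0.
Proof. by apply/matrixP => i j; rewrite !mxE coef0. Qed.

Lemma coef_mxD l B C : coef_mx l (B + C) = coef_mx l B + coef_mx l C.
Proof. by apply/matrixP => i j; rewrite !mxE coefD. Qed.

Lemma coef_mxB l B C : coef_mx l (B - C) = coef_mx l B - coef_mx l C.
Proof. by apply/matrixP => i j; rewrite !mxE coefB. Qed.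

Lemma coef_mx_scalar l (p : {poly R}) :
  coef_mx l (p%:M : 'M[{poly R}]_n) = (p`_l)%:M.
Proof. by apply/matrixP => i j; rewrite !mxE coefMn. Qed.

Lemma coef_mx_mulC l x B :
  coef_mx l (map_mx polyC x *m B) = x *m coef_mx l B.
Proof.
apply/matrixP => i j; rewrite !mxE coef_sum.
by apply: eq_bigr => k _; rewrite !mxE coefCM.
Qed.

Lemma coef_mx_mulCr l x B :
  coef_mx l (B *m map_mx polyC x) = coef_mx l B *m x.
Proof.
apply/matrixP => i j; rewrite !mxE coef_sum.
by apply: eq_bigr => k _; rewrite !mxE coefMC.
Qed.

Lemma coef_mx_scaleX l B :
  coef_mx l ('X *: B) = shift (fun l => coef_mx l B) l.
Proof.
by apply/matrixP => i j; rewrite !mxE coefXM; case: l => *; rewrite mxE.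
Qed.

Lemma coef_trace l B : (\tr B)`_l = \tr (coef_mx l B).
Proof. by rewrite coef_sum; apply: eq_bigr => i _; rewrite mxE. Qed.

End CoefMx.

Section Words.
Variables (R : comNzRingType) (n : nat) (A x : 'M[R]_n).

Definition linear_pencil : 'M[{poly R}]_n :=
  map_mx polyC x + 'X *: map_mx polyC A.

Lemma coef_pencil_exp0 l : coef_mx l (linear_pencil ^+ 0) = (l == 0%N)%:R%:M.
Proof. by rewrite expr0 coef_mx_scalar coef1. Qed.

Lemma coef_pencil_expS m l : coef_mx l (linear_pencil ^+ m.+1) =
    x *m coef_mx l (linear_pencil ^+ m) +
    shift (fun l => A *m coef_mx l (linear_pencil ^+ m)) l.
Proof.
rewrite exprS -[_ * _]/(_ *m _) {1}/linear_pencil mulmxDl coef_mxD coef_mx_mulC.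
by rewrite -scalemxAl coef_mx_scaleX; case: l => //= l; rewrite coef_mx_mulC.
Qed.

Lemma coef_pencil_exp_gt m l : (m < l)%N -> coef_mx l (linear_pencil ^+ m) = 0.
Proof.
elim: m l => [|m IHm] [//|l] ml; first by rewrite coef_pencil_exp0 /= raddf0.
by rewrite coef_pencil_expS /= !IHm ?mulmx0 ?addr0 // ltnW.
Qed.

(** The sum of all products of k factors x and l factors A. *)
Definition words (k l : nat) : 'M[R]_n := coef_mx l (linear_pencil ^+ (k + l)).

(** Split the words according to their first letter. *)
Lemma words_rec k l :
  words k l = ((k == 0%N) && (l == 0%N))%:R%:M
    + shift (fun k => x *m words k l) k + shift (fun l => A *m words k l) l.
Proof.
case: k l => [|k] [|l]; rewrite /words /= ?addr0 ?raddf0 ?add0r.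
- exact: coef_pencil_exp0.
- by rewrite !add0n coef_pencil_expS /= coef_pencil_exp_gt ?mulmx0 ?add0r.
- by rewrite !addn0 coef_pencil_expS /= addr0.
- by rewrite addSn coef_pencil_expS /= addnS.
Qed.

End Words.

(** * Newton's identities for det (1 - t A - z x) *)

Definition convolution (R : comNzRingType) n (c : nat -> nat -> R)
    (W : nat -> nat -> 'M[R]_n) (k l : nat) : 'M[R]_n :=
  \sum_(i < k.+1) \sum_(j < l.+1) c (k - i)%N (l - j)%N *: W i j.

(** Multiplying the generating series of the words by the scalar series c only
  changes the constant term 1 of the recurrence into c. *)
Lemma convolution_rec (R : comNzRingType) n (A x : 'M[R]_n)
    (c : nat -> nat -> R) k l :
  convolution c (words A x) k l = (c k l)%:M
    + shift (fun k => x *m convolution c (words A x) k l) k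
    + shift (fun l => A *m convolution c (words A x) k l) l.
Proof.
rewrite {1}/convolution.
under eq_bigr => i _.
  under eq_bigr => j _ do rewrite words_rec !scalerDr.
  rewrite !big_split /=; over.
rewrite !big_split /=; congr (_ + _ + _).
- rewrite !big_ord_recl /= !subn0 scalemx1 [X in _ + X]big1 ?addr0 => [|i _].
    by rewrite big1 ?addr0 // => j _; rewrite raddf0 scaler0.
  by rewrite big1 // => j _; rewrite raddf0 scaler0.
- rewrite big_ord_recl /= big1 ?add0r => [|j _]; last by rewrite scaler0.
  case: k => [|k]; first by rewrite big_ord0.
  rewrite /= mulmx_sumr; apply: eq_bigr => i _.
  by rewrite mulmx_sumr; apply: eq_bigr => j _; rewrite -scalemxAr subSS.
- under eq_bigr => i _ do rewrite big_ord_recl /= scaler0 add0r.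
  case: l => [|l]; first by rewrite big1 // => i _; rewrite big_ord0.
  rewrite /= mulmx_sumr; apply: eq_bigr => i _.
  by rewrite mulmx_sumr; apply: eq_bigr => j _; rewrite -scalemxAr subSS.
Qed.

Lemma convolution_unique (R : comNzRingType) n (A x : 'M[R]_n)
    (c : nat -> nat -> R) (U : nat -> nat -> 'M[R]_n) :
  (forall k l, U k l = (c k l)%:M + shift (fun k => x *m U k l) k
                       + shift (fun l => A *m U k l) l) ->
  forall k l, U k l = convolution c (words A x) k l.
Proof.
move=> Urec; suff H s k l : (k + l < s)%N -> U k l = convolution c (words A x) k l.
  by move=> k l; apply: H (leqnn _).
elim: s k l => // s IHs k l ltkl; rewrite Urec convolution_rec.
by congr (_ + _ + _); [case: k ltkl => //= k ltkl|case: l ltkl => //= l ltkl];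
  rewrite IHs //; move: ltkl; rewrite ?addnS ?addSn ltnS.
Qed.

Section CharPoly.
Variables (R : comNzRingType) (n : nat) (A x : 'M[R]_n).

(** The matrix 1 - t A - z x, where z is the outer and t the inner variable. *)
Definition char_mx2 : 'M[{poly {poly R}}]_n :=
  map_mx polyC (1%:M - 'X *: map_mx polyC A)
  - 'X *: map_mx polyC (map_mx polyC x).

Definition char_coef (k l : nat) : R := (\det char_mx2)`_k`_l.

Definition adj_coef (k l : nat) : 'M[R]_n :=
  coef_mx l (coef_mx k (\adj char_mx2)).

(** The product of 1 - t A - z x and its adjugate is its determinant; compare the
  coefficients of z^k t^l. *)
Lemma adj_coef_rec k l : adj_coef k l = (char_coef k l)%:M
  + shift (fun k => x *m adj_coef k l) k + shift (fun l => A *m adj_coef k l) l.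
Proof.
have := congr1 (fun B => coef_mx l (coef_mx k B)) (mul_mx_adj char_mx2).
rewrite /= !coef_mx_scalar -/(char_coef k l) {1}/char_mx2 mulmxBl !coef_mxB.
rewrite coef_mx_mulC -scalemxAl coef_mx_scaleX mulmxBl mul1mx coef_mxB.
rewrite -scalemxAl coef_mx_scaleX -/(adj_coef k l) => <-.
have -> : shift (fun l => coef_mx l (map_mx polyC A *m
    coef_mx k (\adj char_mx2))) l = shift (fun l => A *m adj_coef k l) l.
  by case: l => //= l; rewrite coef_mx_mulC.
have -> : coef_mx l (shift (fun k => coef_mx k (map_mx polyC
    (map_mx polyC x) *m \adj char_mx2)) k) = shift (fun k => x *m adj_coef k l) k.
  by case: k => [|k] /=; rewrite ?coef_mx0 // !coef_mx_mulC.
by rewrite addrNK addrNK.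
Qed.

(** By Jacobi's formula the derivative of det (1 - t A - z x) in z is minus the
  trace of its adjugate times x, and the adjugate is the determinant times the
  inverse of 1 - t A - z x, which is the generating series of the words. *)
Lemma char_coef_newton k l :
  k.+1%:R * char_coef k.+1 l = - \sum_(i < k.+1) \sum_(j < l.+1)
    char_coef (k - i) (l - j) * \tr (words A x i j *m x).
Proof.
have -> : k.+1%:R * char_coef k.+1 l = (\det char_mx2)^`()`_k`_l.
  by rewrite coef_deriv coefMn mulr_natl.
have -> : (\det char_mx2)^`()`_k`_l = - \tr (adj_coef k l *m x).
  rewrite deriv_det.
  have -> : map_mx (@deriv {poly R}) char_mx2 =
      - map_mx polyC (map_mx polyC x).
    apply/matrixP => i j; rewrite !mxE derivB derivC derivM derivX derivC.
    by rewrite mul1r mulr0 addr0 sub0r.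
  by rewrite mulmxN raddfN /= !coefN !coef_trace !coef_mx_mulCr.
congr (- _); rewrite (convolution_unique adj_coef_rec) mulmx_suml raddf_sum /=.
apply: eq_bigr => i _; rewrite mulmx_suml raddf_sum /=.
by apply: eq_bigr => j _; rewrite -scalemxAl mxtraceZ.
Qed.

End CharPoly.

Definition total_degree_le (R : comNzRingType) (m : nat) (p : {poly {poly R}}) :=
  forall k l, (m < k + l)%N -> p`_k`_l = 0.

Lemma total_degree_prod (R : comNzRingType) (I : Type) (r : seq I)
    (p : I -> {poly {poly R}}) :
  (forall i, total_degree_le 1 (p i)) ->
  total_degree_le (size r) (\prod_(i <- r) p i).
Proof.
move=> p1; elim: r => [|a r IHr] k l ltkl.
  rewrite big_nil coef1; case: k ltkl => [|k] /=; last by rewrite coef0.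
  by rewrite coef1; case: l.
rewrite big_cons coefM coef_sum big1 // => i _; rewrite coefM big1 // => j _.
have [lt1|le1] := ltnP 1 (i + j); first by rewrite p1 // mul0r.
by rewrite IHr ?mulr0 //; move: i j ltkl le1 => [i /= _] [j /= _]; lia.
Qed.

(** The entries of 1 - t A - z x have total degree at most 1, and each term of the
  Leibniz expansion is a product of n of them. *)
Lemma char_coef_gt (R : comNzRingType) n (A x : 'M[R]_n) k l :
  (n < k + l)%N -> char_coef A x k l = 0.
Proof.
move=> ltn; rewrite /char_coef /determinant !coef_sum big1 // => s _.
have signC (b : bool) : (-1) ^+ b = ((-1) ^+ b)%:P%:P :> {poly {poly R}}.
  by rewrite !rmorphXn !rmorphN1.
rewrite signC !coefCM total_degree_prod ?mulr0 //; last first.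
  by rewrite /index_enum -enumT size_enum_ord.
move=> i {ltn}k {}l ltkl; rewrite !mxE !(coefB, coefC, coefXM).
case: k l ltkl => [|[|k]] [|[|l]] //= _;
  rewrite ?(coef0, coefB, coefC, coefXM, coefMn, coef1) /=.
all: by rewrite ?mul0rn !subr0.
Qed.

(** * The two families as traces of words *)

Section TraceWords.
Variables (R : comNzRingType) (n : nat) (A x : 'M[R]_n).

(** Compare the coefficients in the derivative of Tr (x + lambda A)^(k+l) with
  respect to lambda. *)
Lemma trace_words_A k l : l%:R * \tr (words A x k l) =
  (k + l)%:R * \tr (shift (fun l => A *m words A x k l) l).
Proof.
case: l => [|l] /=; first by rewrite mxtrace0 mul0r mulr0.
set Y := linear_pencil A x.
have YA : map_mx (@deriv R) Y = map_mx polyC A.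
  apply/matrixP => i j; rewrite !mxE derivD derivM derivX !derivC.
  by rewrite mulr0 addr0 mul1r add0r.
pose dY m := map_mx (@deriv R) (Y ^+ m).
have dY0 : dY 0%N = 0.
  by apply/matrixP => i j; rewrite !mxE derivMn derivC mul0rn.
have dYS m : dY m.+1 = map_mx polyC A *m Y ^+ m + Y *m dY m.
  rewrite -YA /dY exprS -[_ * _]/(_ *m _); apply/matrixP => i j.
  rewrite !mxE (raddf_sum (@deriv R)) -big_split; apply: eq_bigr => h _.
  by rewrite /= derivM !mxE.
have := congr1 (coefp l) (trace_deriv_exp dY0 dYS (k + l)%N).
rewrite /coefp mulr_natl coefMn !coef_trace coef_mx_mulCr mxtrace_mulC.
rewrite -/(words A x k l) => E.
rewrite addnS !mulr_natl -E -raddfMn /=; congr (\tr _).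
by apply/matrixP => i j; rewrite /words addnS mulmxnE !mxE coef_deriv.
Qed.

(** Among the words with k + 1 letters x and l letters A, those that start with
  A contribute to the trace the fraction l / (k + 1 + l) by [trace_words_A];
  the others start with x. *)
Lemma trace_words_x k l :
  (k.+1 + l)%:R * \tr (words A x k l *m x) = k.+1%:R * \tr (words A x k.+1 l).
Proof.
rewrite mxtrace_mulC; apply: (addIr (l%:R * \tr (words A x k.+1 l))).
rewrite -mulrDl -natrD [in LHS]trace_words_A -mulrDr -raddfD.
by rewrite [words A x k.+1 l]words_rec /= raddf0 add0r.
Qed.

End TraceWords.

Section Families.
Variables (K : numFieldType) (n : nat).
Implicit Types (A x : 'M[K]_n).

(** In the k-th power of the series x + A x t + A^2 x t^2 + ..., the coefficient
  of t^l collects the words with k letters x and l letters A that end in x. *)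
Lemma fps_exp_words A x k l :
  fps_exp (fun j => iter j (left_mul A) x) k.+1 l = words A x k l *m x.
Proof.
set a := fun j : nat => iter j (left_mul A) x.
have expS k' l' : fps_exp a k'.+1 l' = x *m fps_exp a k' l' +
    shift (fun l => A *m fps_exp a k'.+1 l) l'.
  rewrite [LHS]big_ord_recl /= subn0; congr (_ + _).
  case: l' => [|l']; first by rewrite big_ord0.
  rewrite /= /fps_mul mulmx_sumr; apply: eq_bigr => i _.
  by rewrite subSS /= mulmxA.
suff H s : forall k l, (k + l < s)%N -> fps_exp a k.+1 l = words A x k l *m x.
  exact: (H _ _ _ (leqnn _)).
elim: s => // s IHs {}k {}l ltkl; rewrite expS words_rec !mulmxDl.
congr (_ + _); last first.
  case: l ltkl => [|l] ltkl; rewrite /shift; first by rewrite mul0mx.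
  by rewrite -mulmxA IHs //; move: ltkl; rewrite addnS.
case: k ltkl => [|k] ltkl; rewrite /shift; last first.
  by rewrite [X in X%:M]/= raddf0 mul0mx add0r -mulmxA IHs.
rewrite mul0mx addr0 /fps_exp /= /fps_one -scalemx1 -scalemxAl mul1mx scaler_nat.
by rewrite -[_ *m _]/(_ * _) mulr_natr.
Qed.

Lemma h_funE A m l x :
  h_fun A m l x = m%:R^-1 * \tr (coef_mx l (linear_pencil A x ^+ m)).
Proof. by rewrite /h_fun coefZ coef_trace. Qed.

Lemma f_funE A k l x : f_fun A k.+1 l x = \tr (words A x k l *m x).
Proof. by rewrite /f_fun fps_exp_words. Qed.

(** Both sides are multiples of the trace of W_(k+1,l), by [trace_words_x]. *)
Lemma f_fun_h_fun A k l x :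
  f_fun A k.+1 l x = k.+1%:R * h_fun A (k.+1 + l) l x.
Proof.
by rewrite f_funE h_funE mulrCA -trace_words_x mulKf.
Qed.

(** In particular d_0l does not depend on x. *)
Lemma char_coef0E A x l :
  char_coef A x 0 l = (\det (1%:M - 'X *: map_mx polyC A))`_l.
Proof.
rewrite /char_coef -horner_coef0 -horner_evalE -det_map_mx.
congr (nth 0 (polyseq _) l).
congr (\det _).
apply/matrixP => i j; rewrite [LHS]mxE -[LHS]/((char_mx2 A x i j).[0]) !mxE.
by rewrite !(hornerE, mul0r, subr0).
Qed.

Lemma char_coef00 A x : char_coef A x 0 0 = 1.
Proof.
rewrite char_coef0E -horner_coef0 -horner_evalE -det_map_mx -[RHS](det1 _ n).
congr (\det _); apply/matrixP => i j; rewrite [LHS]mxE.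
rewrite -[LHS]/(((1%:M - 'X *: map_mx polyC A) i j).[0]) !mxE.
by rewrite !(hornerE, mul0r, subr0); case: (i == j); rewrite hornerE.
Qed.

Lemma char_coef_f_fun A x k l :
  k.+1%:R * char_coef A x k.+1 l = - \sum_(i < k.+1) \sum_(j < l.+1)
    char_coef A x (k - i) (l - j) * f_fun A i.+1 j x.
Proof.
rewrite char_coef_newton; congr (- _); apply: eq_bigr => i _.
by apply: eq_bigr => j _; rewrite f_funE.
Qed.

End Families.

(** * Subrings of functions *)

(** Membership of the coefficients in a class of functions is needed for three
  classes: holomorphic functions of a family, differentiable functions, and
  functions polynomial on every line.  The proof is the same for each, from
  these closure properties. *)
Record ring_closed (T : Type) (K : pzRingType) (P : (T -> K) -> Prop) : Prop :=
  RingClosed {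
    closed_cst : forall c, P (fun _ => c);
    closedD : forall f g, P f -> P g -> P (fun x => f x + g x);
    closedM : forall f g, P f -> P g -> P (fun x => f x * g x) }.

Section RingClosed.
Variables (T : Type) (K : comNzRingType) (P : (T -> K) -> Prop).
Hypothesis Pring : ring_closed P.

Lemma closed_sum (I : Type) (r : seq I) (Q : pred I) (F : I -> T -> K) :
  (forall i, Q i -> P (F i)) -> P (fun x => \sum_(i <- r | Q i) F i x).
Proof.
move=> PF; elim: r => [|a r IHr].
  under eq_fun do rewrite big_nil.
  exact: (closed_cst Pring).
under eq_fun do rewrite big_cons.
move: (PF a); case: (Q a) => // PFa.
by apply: (closedD Pring) => //; apply: PFa.
Qed.

Lemma closed_prod (I : Type) (r : seq I) (F : I -> T -> K) :
  (forall i, P (F i)) -> P (fun x => \prod_(i <- r) F i x).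
Proof.
move=> PF; elim: r => [|a r IHr].
  under eq_fun do rewrite big_nil.
  exact: (closed_cst Pring).
under eq_fun do rewrite big_cons.
exact: (closedM Pring).
Qed.

Lemma closedN f : P f -> P (fun x => - f x).
Proof.
move=> Pf; under eq_fun do rewrite -mulN1r.
by apply: (closedM Pring) => //; apply: (closed_cst Pring).
Qed.

Lemma closed_det m (S : T -> 'M[K]_m) :
  (forall i j, P (fun x => S x i j)) -> P (fun x => \det (S x)).
Proof.
move=> PS; apply: closed_sum => s _; apply: (closedM Pring).
  exact: (closed_cst Pring).
exact: closed_prod.
Qed.

Lemma closed_adj m (S : T -> 'M[K]_m) :
  (forall i j, P (fun x => S x i j)) ->
  forall i j, P (fun x => (\adj (S x)) i j).
Proof.
move=> PS i j; under eq_fun do rewrite mxE.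
apply: (closedM Pring); first exact: (closed_cst Pring).
by apply: closed_det => a b; under eq_fun do rewrite !mxE.
Qed.

Lemma closed_mulmx m p q (S : T -> 'M[K]_(m, p)) (S' : T -> 'M[K]_(p, q)) :
  (forall i j, P (fun x => S x i j)) -> (forall i j, P (fun x => S' x i j)) ->
  forall i j, P (fun x => (S x *m S' x) i j).
Proof.
move=> PS PS' i j; under eq_fun do rewrite mxE.
by apply: closed_sum => k _; apply: (closedM Pring).
Qed.

End RingClosed.

(** * Newton's identities inside a subring of functions *)

Section Generation.
Variables (K : numFieldType) (n : nat) (A : 'M[K]_n).
Variable P : ('M[K]_n -> K) -> Prop.
Hypothesis Pring : ring_closed P.

Lemma closed_f_fun k l :
  (forall i j, P (fun x => x i j)) -> P (f_fun A k.+1 l).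
Proof.
move=> Pcoord.
have -> : f_fun A k.+1 l = (fun x => \tr (words A x k l *m x)).
  by apply/funext => x; rewrite f_funE.
suff PW i j : P (fun x => words A x k l i j).
  by apply: (closed_sum Pring) => i _; apply: (closed_mulmx Pring).
suff H s : forall k l i j, (k + l < s)%N -> P (fun x => words A x k l i j).
  exact: H (leqnn _).
elim: s => // s IHs {}k {}l {}i {}j ltkl.
under eq_fun do rewrite words_rec 2!mxE.
apply: (closedD Pring); first apply: (closedD Pring).
- under eq_fun do rewrite mxE.
  exact: (closed_cst Pring).
- case: k ltkl => [|k] ltkl /=.
    under eq_fun do rewrite mxE.
    exact: (closed_cst Pring).
  by apply: (closed_mulmx Pring) => // a b; apply: IHs.
- case: l ltkl => [|l] ltkl /=.
    under eq_fun do rewrite mxE.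
    exact: (closed_cst Pring).
  apply: (closed_mulmx Pring) => a b; first exact: (closed_cst Pring).
  by apply: IHs; move: ltkl; rewrite addnS.
Qed.

Let Psum := @closed_sum _ _ _ Pring.

(** Newton's identities, solved for d_kl by recursion on k. *)
Lemma closed_char_coef k l :
  (forall i j, (i < k)%N -> (j <= l)%N -> P (f_fun A i.+1 j)) ->
  P (fun x => char_coef A x k l).
Proof.
elim/ltn_ind: k l => -[|k] IHk l Pf.
  under eq_fun do rewrite char_coef0E.
  exact: (closed_cst Pring).
have -> : (fun x => char_coef A x k.+1 l) = (fun x => k.+1%:R^-1 *
    - \sum_(i < k.+1) \sum_(j < l.+1)
        char_coef A x (k - i) (l - j) * f_fun A i.+1 j x).
  by apply/funext => x; rewrite -char_coef_f_fun mulKf ?pnatr_eq0.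
apply: (closedM Pring); first exact: (closed_cst Pring).
apply: (closedN Pring); apply: Psum => i _; apply: Psum => j _.
apply: (closedM Pring); last by apply: Pf; rewrite // -ltnS.
apply: IHk; first by rewrite ltnS leq_subr.
by move=> a b lta leb; apply: Pf; move: (ltn_ord i) (ltn_ord j); lia.
Qed.

(** Newton's identities, solved for f_(k+1,l), whose coefficient is d_00 = 1. *)
Lemma closed_f_fun_of_char_coef k l :
  (forall i j, (i <= k.+1)%N -> (j <= l)%N -> P (fun x => char_coef A x i j)) ->
  P (f_fun A k.+1 l).
Proof.
elim/ltn_ind: k l => k IHk l; elim/ltn_ind: l => l IHl Pd.
have -> : f_fun A k.+1 l = (fun x => - (k.+1%:R * char_coef A x k.+1 l +
    (\sum_(i < k) \sum_(j < l.+1)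
        char_coef A x (k - i) (l - j) * f_fun A i.+1 j x +
     \sum_(j < l) char_coef A x 0 (l - j) * f_fun A k.+1 j x))).
  apply/funext => x; rewrite char_coef_f_fun big_ord_recr /= subnn.
  rewrite [\sum_(j < l.+1) char_coef A x 0 _ * _]big_ord_recr /= subnn.
  rewrite char_coef00 mul1r.
  by rewrite [X in - X + _]addrA opprD opprK [X in X - _]addrC addrK.
apply: (closedN Pring); apply: (closedD Pring); last apply: (closedD Pring).
- by apply: (closedM Pring); [exact: (closed_cst Pring)|exact: Pd].
- apply: Psum => i _; apply: Psum => j _; have ltj := ltn_ord j.
  apply: (closedM Pring); first by apply: Pd; lia.
  by apply: IHk => // a b lea leb; apply: Pd; move: (ltn_ord i); lia.
- apply: Psum => j _; have ltj := ltn_ord j.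
  apply: (closedM Pring); first by apply: Pd; lia.
  by apply: IHl => // a b lea leb; apply: Pd; lia.
Qed.

End Generation.

(** * The linear system at a fixed power of t *)

Section Cramer.
Variables (T : Type) (K : fieldType) (O : set T) (P : (T -> K) -> Prop).

(** Division is stated as cancellation on O: u is determined by g and g u there,
  whatever its values elsewhere. *)
Definition division_closed := forall g u : T -> K,
  (forall x, O x -> g x != 0) -> P g -> P (fun x => g x * u x) -> P u.

Hypotheses (Pring : ring_closed P) (Pdiv : division_closed).

Lemma closed_cramer m (S : T -> 'M[K]_m) (b u : T -> 'cV[K]_m) :
    (forall x, O x -> \det (S x) != 0) -> (forall x, S x *m u x = b x) ->
    (forall i j, P (fun x => S x i j)) -> (forall i, P (fun x => b x i 0)) ->
  forall i, P (fun x => u x i 0).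
Proof.
move=> detS Su PS Pb i; apply: (Pdiv detS); first exact: (closed_det Pring).
have -> : (fun x => \det (S x) * u x i 0) = (fun x => (\adj (S x) *m b x) i 0).
  by apply/funext => x; rewrite -Su mulmxA mul_adj_mx mul_scalar_mx mxE.
apply: (closed_mulmx Pring); first exact: (closed_adj Pring).
by move=> j k; rewrite (ord1 k).
Qed.

End Cramer.

(** The matrix of Newton's identities for t^l, on matrices of size m + l: row k holds
  the coefficients of the identity for z^(k+1), the first m columns belong to
  the unknowns d_(1,l), ..., d_(m,l), and the last l columns to the unknowns
  f_(1,l), ..., f_(l,l).  The entries involve only phi_i = f_i0 and
  delta_i = d_i0. *)
Definition level_mx (K : comNzRingType) (m l : nat) (phi delta : nat -> K) :
    'M[K]_(m + l) :=
  row_mx (\matrix_(k < m + l, c < m)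
            (if (c < k)%N then phi (k - c)%N else k.+1%:R *+ (c == k :> nat)))
         (\matrix_(k < m + l, i < l)
            (if (i < k.+1)%N then delta (k - i)%N else 0)).

Section LevelEquation.
Variables (K : numFieldType) (n : nat) (A : 'M[K]_n).

(** Minus the terms of Newton's identity for z^(k+1) t^(l+1) that are already known:
  products of entries of lower index in t, the term with d_(0,l+1), and the
  terms with f_(i+1,l+1) for i > l. *)
Definition level_rhs (l : nat) (x : 'M[K]_n) (k : nat) : K :=
  - (\sum_(i < k.+1) \sum_(j < l)
       char_coef A x (k - i) (l - j) * f_fun A i.+1 j.+1 x
     + char_coef A x 0 l.+1 * f_fun A k.+1 0 x
     + \sum_(i < k.+1 | (l.+1 <= i)%N)
         char_coef A x (k - i) 0 * f_fun A i.+1 l.+1 x).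

(** In Newton's identity for z^(k+1) t^(l+1), the sum over the index of t is split
  into its first term, its last term and the rest; the d_(c+1,l+1) with
  c >= m vanish for degree reasons. *)
Lemma level_equation m l (x : 'M[K]_n) : (m + l.+1)%N = n ->
  level_mx m l.+1 (fun i => f_fun A i 0 x) (fun i => char_coef A x i 0) *m
    col_mx (\col_c char_coef A x c.+1 l.+1) (\col_i f_fun A i.+1 l.+1 x)
  = \col_k level_rhs l x k.
Proof.
move=> mln; rewrite mul_row_col; apply/matrixP => k z; rewrite (ord1 z) {z} !mxE.
have ltk := ltn_ord k.
have -> : \sum_(c < m) (\matrix_(k < m + l.+1, c < m)
            (if (c < k)%N then f_fun A (k - c) 0 x else k.+1%:R *+ (c == k :> nat)))
    k c * (\col_c char_coef A x c.+1 l.+1) c 0 =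
  \sum_(i < k) char_coef A x (k - i) l.+1 * f_fun A i.+1 0 x
     + k.+1%:R * char_coef A x k.+1 l.+1.
  pose G c := (if (c < k)%N then f_fun A (k - c) 0 x
    else k.+1%:R *+ (c == k :> nat)) * char_coef A x c.+1 l.+1.
  transitivity (\sum_(c < m + l.+1) G c).
    rewrite big_split_ord [X in _ = _ + X]big1 ?addr0 => [|i _].
      by apply: eq_bigr => c _; rewrite !mxE.
    by rewrite /G /= char_coef_gt ?mulr0 // -mln; lia.
  rewrite (bigID (fun c : 'I__ => (c < k)%N)) /=; congr (_ + _).
    rewrite -(big_ord_widen_cond _ xpredT G (ltnW ltk)) (reindex_inj rev_ord_inj).
    apply: eq_bigr => i _; have lti := ltn_ord i; rewrite /G /= mulrC.
    have [-> ->] : (k - i.+1).+1 = (k - i)%N /\ (k - (k - i.+1))%N = i.+1 by lia.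
    by rewrite ifT //; lia.
  rewrite (bigD1 k) ?ltnn //= big1 ?addr0 => [|c /andP[ck neq]].
    by rewrite /G ltnn eqxx mulr1n.
  have cNk : (c == k :> nat) = false by apply/negbTE.
  by rewrite /G (negPf ck) cNk mulr0n mul0r.
have -> : \sum_(i < l.+1) (\matrix_(k < m + l.+1, i < l.+1)
      (if (i < k.+1)%N then char_coef A x (k - i) 0 else 0)) k i *
      (\col_i f_fun A i.+1 l.+1 x) i 0 =
    \sum_(i < k.+1 | (i < l.+1)%N) char_coef A x (k - i) 0 * f_fun A i.+1 l.+1 x.
  rewrite (big_ord_widen_cond (m + l.+1) (fun i => i < l.+1)%N
    (fun i => char_coef A x (k - i) 0 * f_fun A i.+1 l.+1 x)) //.
  rewrite (eq_bigl (fun i : 'I_(m + l.+1) =>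
    (i < k.+1)%N && (i < l.+1)%N)); last first.
    by move=> i; rewrite andbC.
  rewrite -(big_ord_widen_cond (m + l.+1) (fun i => i < k.+1)%N
    (fun i => char_coef A x (k - i) 0 * f_fun A i.+1 l.+1 x)) ?leq_addl //.
  rewrite [RHS]big_mkcond; apply: eq_bigr => i _; rewrite !mxE.
  by case: ifP => // _; rewrite mul0r.
rewrite char_coef_f_fun /level_rhs.
have -> : \sum_(i < k.+1) \sum_(j < l.+2)
      char_coef A x (k - i) (l.+1 - j) * f_fun A i.+1 j x =
    \sum_(i < k.+1) char_coef A x (k - i) l.+1 * f_fun A i.+1 0 x
    + \sum_(i < k.+1) \sum_(j < l)
        char_coef A x (k - i) (l - j) * f_fun A i.+1 j.+1 x
    + \sum_(i < k.+1) char_coef A x (k - i) 0 * f_fun A i.+1 l.+1 x.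
  rewrite -!big_split; apply: eq_bigr => i _.
  by rewrite big_ord_recl big_ord_recr /= subn0 subnn addrA.
rewrite [\sum_(i < k.+1) _ * f_fun A _ 0 x]big_ord_recr /= subnn.
rewrite [\sum_(i < k.+1) char_coef A x _ 0 * _]
  (bigID (fun i : 'I_k.+1 => i < l.+1)%N) /=.
rewrite [\sum_(i < k.+1 | ~~ _) _]
  (eq_bigl (fun i : 'I_k.+1 => (l < i)%N)); last first.
  by move=> i; rewrite -leqNgt.
ring.
Qed.

End LevelEquation.

(** * Each family determines all the coefficients *)

Section Levels.
Variables (K : numFieldType) (n : nat) (A : 'M[K]_n).

Definition level_det (l : nat) (x : 'M[K]_n) : K :=
  \det (level_mx (n - l.+1) l.+1 (fun i => f_fun A i 0 x)
          (fun i => char_coef A x i 0)).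

Lemma closed_level_mx (m l : nat) (P : ('M[K]_n -> K) -> Prop) :
    ring_closed P -> (forall i, P (f_fun A i.+1 0)) ->
    (forall i, P (fun x => char_coef A x i 0)) ->
  forall i j, P (fun x => level_mx m l (fun i => f_fun A i 0 x)
          (fun i => char_coef A x i 0) i j).
Proof.
move=> Pring Pf Pd k c; rewrite /level_mx -(splitK c).
case: (fintype.split c) => {}c /=.
  under eq_fun do rewrite row_mxEl mxE.
  case: ltnP => [ck|_]; last exact: (closed_cst Pring).
  by rewrite -(prednK (n := k - c)) ?subn_gt0.
under eq_fun do rewrite row_mxEr mxE.
by case: ltnP => [ck|_]; last exact: (closed_cst Pring).
Qed.

Section Descent.
Variables (O : set 'M[K]_n) (P : ('M[K]_n -> K) -> Prop).
Hypotheses (Pring : ring_closed P) (Pdiv : division_closed O P).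
Hypothesis levelO : forall l x, (l.+1 < n)%N -> O x -> level_det l x != 0.
Hypothesis Pf : forall k l, (l <= k < n)%N -> P (f_fun A k.+1 l).

Lemma closed_char_coef_gt k l : (n < k + l)%N -> P (fun x => char_coef A x k l).
Proof.
move=> ltn; under eq_fun do rewrite char_coef_gt //.
exact: (closed_cst Pring).
Qed.

(** Induction on the power of t.  For t^0 the f family contains every f_k0 with
  1 <= k <= n; for higher powers below n, Cramer's rule applies to
  [level_equation]. *)
Lemma char_coef_of_f_family k l : P (fun x => char_coef A x k l).
Proof.
elim/ltn_ind: l k => -[|l] IHl k.
  have [lek|ltk] := leqP k n; last by apply: closed_char_coef_gt; rewrite addn0.
  apply: (closed_char_coef Pring) => i j ltik; rewrite leqn0 => /eqP ->.
  by apply: Pf; rewrite (leq_trans ltik).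
have Plow i j : (j < l.+1)%N -> P (f_fun A i.+1 j).
  move=> ltj; apply: (closed_f_fun_of_char_coef Pring) => a b _ leb.
  by apply: IHl; apply: leq_ltn_trans ltj.
case: k => [|c].
  under eq_fun do rewrite char_coef0E.
  exact: (closed_cst Pring).
have [ltc|lec] := ltnP c (n - l.+1); last by apply: closed_char_coef_gt; lia.
have ltln : (l.+1 < n)%N by lia.
have mln := subnK (ltnW ltln).
have := closed_cramer Pring Pdiv (fun x => @levelO l x ltln)
  (fun x => level_equation A x mln) _ _ (lshift _ (Ordinal ltc)).
have PS := @closed_level_mx (n - l.+1) l.+1 _ Pring
  (fun i => Plow i 0%N isT) (IHl 0%N isT).
move/(_ PS); under eq_fun do rewrite col_mxEu mxE /=.
apply=> k; under eq_fun do rewrite mxE /level_rhs.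
have ltk : (k < n)%N by rewrite -[X in (_ < X)%N]mln.
apply: (closedN Pring); apply: (closedD Pring); first apply: (closedD Pring).
- apply: (closed_sum Pring) => i _; apply: (closed_sum Pring) => j _.
  apply: (closedM Pring); first by apply: IHl; rewrite ltnS leq_subr.
  by apply: Plow; rewrite ltnS.
- apply: (closedM Pring); last exact: Plow.
  by under eq_fun do rewrite char_coef0E; exact: (closed_cst Pring).
- apply: (closed_sum Pring) => i lti; apply: (closedM Pring); first exact: IHl.
  by apply: Pf; rewrite lti /= (leq_trans _ ltk).
Qed.

Lemma f_fun_of_f_family k l : P (f_fun A k.+1 l).
Proof.
apply: (closed_f_fun_of_char_coef Pring) => i j _ _.
exact: char_coef_of_f_family.
Qed.

End Descent.

(** Below the line k + l = n the coefficients d_kl come from Newton's identities,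
  and above it they are zero. *)
Lemma f_fun_of_triangle (P : ('M[K]_n -> K) -> Prop) : ring_closed P ->
  (forall k l, (k.+1 + l <= n)%N -> P (f_fun A k.+1 l)) ->
  forall k l, P (f_fun A k.+1 l).
Proof.
move=> Pring Pf k l; apply: (closed_f_fun_of_char_coef Pring) => i j _ _.
have [le|lt] := leqP (i + j) n.
  by apply: (closed_char_coef Pring) => a b lta leb; apply: Pf; lia.
under eq_fun do rewrite char_coef_gt //.
exact: (closed_cst Pring).
Qed.

End Levels.

(** * Non-vanishing of the determinants of the linear systems *)

Section NonDegenerate.
Variable K : numFieldType.

Lemma euler_vanish (M N : nat) (u : nat -> K) : u 0%N = 0 ->
    (forall k, (k < N)%N ->
       k.+1%:R * u k.+1 + M%:R * \sum_(j < k.+1) u j = 0) ->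
  forall k, (k <= N)%N -> u k = 0.
Proof.
move=> u0 uS; elim/ltn_ind => -[//|k] IHk lek; have := uS k lek.
rewrite big1 ?mulr0 ?addr0 => [/eqP|j _]; last first.
  by apply: IHk => //; move: (ltn_ord j); lia.
by rewrite mulf_eq0 pnatr_eq0 => /eqP.
Qed.

(** Division by 1 - X takes partial sums of the coefficients. *)
Lemma sum_coef_1subX (C : {poly K}) k :
  \sum_(j < k.+1) ((1 - 'X) * C)`_j = C`_k.
Proof.
elim: k => [|k IHk].
  by rewrite big_ord1 mulrBl mul1r coefB coefXM subr0.
by rewrite big_ord_recr /= IHk mulrBl mul1r coefB coefXM /= addrC subrK.
Qed.

(** The coefficient of z^(k+1) in z q' + q M z / (1 - z).  The series M z / (1 - z)
  is the generating series of Tr x^i, for i >= 1, when x is an idempotent of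
  trace M; it is also minus the logarithmic derivative z d'/d of
  d = (1 - z)^M. *)
Definition euler_op (M k : nat) (q : {poly K}) : K :=
  k.+1%:R * q`_k.+1 + M%:R * \sum_(j < k.+1) q`_j.

Lemma euler_opD M k p q : euler_op M k (p + q) = euler_op M k p + euler_op M k q.
Proof.
rewrite /euler_op coefD; under eq_bigr do rewrite coefD.
by rewrite big_split /= !mulrDr addrACA.
Qed.

Lemma euler_opZ M k a p : euler_op M k (a *: p) = a * euler_op M k p.
Proof.
rewrite /euler_op coefZ; under eq_bigr do rewrite coefZ.
by rewrite -mulr_sumr mulrDr !(mulrCA a).
Qed.

Lemma euler_op_sum M k (I : Type) (r : seq I) (F : I -> {poly K}) :
  euler_op M k (\sum_(i <- r) F i) = \sum_(i <- r) euler_op M k (F i).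
Proof.
elim: r => [|a r IHr]; last by rewrite !big_cons euler_opD IHr.
by rewrite !big_nil -(scale0r 0) euler_opZ mul0r.
Qed.

Lemma euler_op_Xn M k c :
  euler_op M k 'X^(c.+1) = if (c < k)%N then M%:R else k.+1%:R *+ (c == k).
Proof.
rewrite /euler_op coefXn eqSS eq_sym; case: ltnP => [ltck|lekc].
  rewrite (ltn_eqF ltck) mulr0 add0r (bigD1 (Ordinal (ltck : c.+1 < k.+1)%N)) //=.
  rewrite coefXn eqxx big1 ?addr0 ?mulr1 // => j neq; rewrite coefXn.
  by case: eqP => // jc; case/eqP: neq; apply: val_inj.
rewrite big1 ?mulr0 ?addr0 ?mulr_natr // => j _; rewrite coefXn.
by rewrite ltn_eqF // ltnS (leq_trans _ lekc) // -ltnS.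
Qed.

(** The operator sends d q to z d q' for d = (1 - z)^(M+1), because it kills d. *)
Lemma euler_op_1subX M k (q : {poly K}) :
  euler_op M.+1 k ((1 - 'X) ^+ M.+1 * q) = ((1 - 'X) ^+ M.+1 * q^`())`_k.
Proof.
set C := (1 - 'X) ^+ M * q.
have BE : (1 - 'X) ^+ M.+1 * q = (1 - 'X) * C by rewrite exprS mulrA.
have dB : ((1 - 'X) ^+ M.+1 * q)^`() = - (C *+ M.+1) + (1 - 'X) ^+ M.+1 * q^`().
  rewrite derivM deriv_exp derivB derivX derivC sub0r /=.
  by rewrite mulN1r mulrnAl mulNr mulNrn.
rewrite /euler_op; under eq_bigr do rewrite BE.
rewrite sum_coef_1subX mulr_natl -coef_deriv dB coefD coefN coefMn mulr_natl.
by rewrite addrAC addNr add0r.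
Qed.

Lemma size_1subX_exp M : size ((1 - 'X : {poly K}) ^+ M) = M.+1.
Proof.
have sz : size (1 - 'X : {poly K}) = 2 by rewrite -opprB size_opp size_XsubC.
have nz : (1 - 'X : {poly K}) ^+ M != 0 by rewrite expf_neq0 // -size_poly_eq0 sz.
by rewrite -(prednK (n := size _)) ?size_poly_gt0 // size_exp sz mul1n.
Qed.

(** The values of d_i0 at an idempotent of trace M. *)
Definition idempotent_delta (M i : nat) : K := ((1 - 'X) ^+ M)`_i.

(** Encode a kernel vector as polynomials p (the unknowns d) and Psi (such that
  z Psi' carries the unknowns f).  The rows say that the Euler operator kills
  p + (1 - z)^(m+1) Psi up to order m + 1 + l, which bounds its degree, so that
  p = - (1 - z)^(m+1) Psi; since Psi vanishes at 0 and p has degree at most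
  m + 1, both are zero. *)
Lemma level_mx_kernel m l (v : 'cV[K]_(m.+1 + l)) :
  level_mx m.+1 l (fun _ => m.+1%:R) (idempotent_delta m.+1) *m v = 0 -> v = 0.
Proof.
move=> Sv.
pose p : {poly K} := \sum_(c < m.+1) v (lshift l c) 0 *: 'X^(c.+1).
pose Phi : {poly K} := \sum_(i < l) v (rshift m.+1 i) 0 *: 'X^i.
pose Psi : {poly K} := \sum_(i < l) (v (rshift m.+1 i) 0 / i.+1%:R) *: 'X^(i.+1).
have PsiD : Psi^`() = Phi.
  rewrite raddf_sum; apply: eq_bigr => i _ /=.
  by rewrite derivZ derivXn /= -scalerMnr scalerMnl -mulr_natr divfK ?pnatr_eq0.
pose B := (1 - 'X) ^+ m.+1 * Psi.
have coefp c : p`_(c : 'I_m.+1).+1 = v (lshift l c) 0.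
  rewrite coef_sum (bigD1 c) //= coefZ coefXn eqxx mulr1 big1 ?addr0 // => j jc.
  by rewrite coefZ coefXn eqSS eq_sym val_eqE (negPf jc) mulr0.
have coefPsi i : Psi`_(i : 'I_l).+1 = v (rshift m.+1 i) 0 / i.+1%:R.
  rewrite coef_sum (bigD1 i) //= coefZ coefXn eqxx mulr1 big1 ?addr0 // => j ji.
  by rewrite coefZ coefXn eqSS eq_sym val_eqE (negPf ji) mulr0.
have p0 : p`_0 = 0 by rewrite coef_sum big1 // => c _; rewrite coefZ coefXn mulr0.
have Psi0 : Psi`_0 = 0.
  by rewrite coef_sum big1 // => c _; rewrite coefZ coefXn mulr0.
have szp : (size p <= m.+2)%N.
  apply: (leq_trans (size_sum _ _ _)); apply/bigmax_leqP => c _.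
  by apply: (leq_trans (size_scale_leq _ _)); rewrite size_polyXn ltnS.
have szPsi : (size Psi <= l.+1)%N.
  apply: (leq_trans (size_sum _ _ _)); apply/bigmax_leqP => c _.
  by apply: (leq_trans (size_scale_leq _ _)); rewrite size_polyXn ltnS.
(* The rows control the coefficients up to m + 1 + l, which bounds the degree. *)
have eq_p_B : p + B = 0.
  apply/polyP => k; rewrite coef0.
  have [lek|ltk] := leqP k (m.+1 + l); last first.
    rewrite nth_default // (leq_trans (size_polyD _ _)) // geq_max.
    apply/andP; split; first by apply: leq_trans szp _; lia.
    by apply: (leq_trans (size_polyMleq _ _)); rewrite size_1subX_exp; lia.
  apply: (@euler_vanish m.+1 (m.+1 + l) (fun k => (p + B)`_k)) lek => [|{}k ltk].
    by rewrite coefD p0 add0r -horner_coef0 hornerM !horner_coef0 Psi0 mulr0.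
  rewrite -/(euler_op _ _ _) euler_opD euler_op_1subX PsiD.
  have /matrixP/(_ (Ordinal ltk) 0) := Sv.
  rewrite -[v in LHS]vsubmxK mul_row_col !mxE => rowk.
  rewrite -[RHS]rowk; congr (_ + _).
    rewrite euler_op_sum; apply: eq_bigr => c _.
    by rewrite euler_opZ euler_op_Xn !mxE mulrC.
  rewrite /Phi mulr_sumr coef_sum; apply: eq_bigr => i _.
  rewrite -scalerAr coefZ coefMXn !mxE mulrC ltnS; congr (_ * _).
  by rewrite ltnNge; case: leqP.
have Psi_0 : Psi = 0.
  apply/eqP; apply: contraT => Psi_n0.
  have szPsi2 : (1 < size Psi)%N.
    rewrite ltnNge; apply: contra Psi_n0 => /size1_polyC ->.
    by rewrite Psi0.
  have := szp; rewrite (_ : p = - B); last by apply/eqP; rewrite -addr_eq0 eq_p_B.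
  rewrite size_opp size_mul ?expf_neq0 // -?size_poly_eq0 ?size_1subX_exp //.
    case: (size Psi) szPsi2 => [|[|s]] // _.
    by rewrite !addnS !addSn /= leqNgt !ltnS leq_addr.
  by rewrite -opprB size_opp size_XsubC.
have p_0 : p = 0 by move: eq_p_B; rewrite /B Psi_0 mulr0 addr0.
rewrite -[v]vsubmxK; apply/matrixP => i z; rewrite (ord1 z) -(splitK i).
case: (fintype.split i) => {}i /=.
  by rewrite col_mxEu !mxE -coefp p_0 coef0.
rewrite col_mxEd !mxE; apply: (divIf (_ : i.+1%:R != 0 :> K)).
  by rewrite pnatr_eq0.
by rewrite -coefPsi Psi_0 coef0 mul0r.
Qed.

Lemma level_mx_det m l :
  \det (level_mx m.+1 l (fun _ => m.+1%:R : K) (idempotent_delta m.+1)) != 0.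
Proof.
set S := level_mx _ _ _ _.
rewrite -unitfE -unitmxE -unitmx_tr -row_free_unit -kermx_eq0.
apply/rowV0P => v /sub_kermxP vS; apply: (can_inj (@trmxK _ _ _)).
rewrite trmx0; apply: (@level_mx_kernel m l).
by rewrite -/S -[S]trmxK -trmx_mul vS trmx0.
Qed.

Lemma level_mx_ext m l (phi phi' delta delta' : nat -> K) :
    (forall i, phi i.+1 = phi' i.+1) -> delta =1 delta' ->
  level_mx m l phi delta = level_mx m l phi' delta'.
Proof.
move=> e_phi e_delta; congr row_mx; apply/matrixP => k c; rewrite !mxE.
  by case: ltnP => // ck; rewrite -(prednK (n := k - c)) ?subn_gt0.
by rewrite e_delta.
Qed.

(** The witness is an idempotent of rank n - l - 1. *)
Lemma level_det_neq0 n (A : 'M[K]_n) l : (l.+1 < n)%N ->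
  exists x, level_det A l x != 0.
Proof.
move=> ltln; pose M := (n - l.+1)%N.
have MS : M = M.-1.+1 by rewrite prednK // subn_gt0.
pose x : 'M[K]_n := pid_mx M.
have xx : x *m x = x by apply: pid_mx_id; apply: leq_subr.
have trx : \tr x = M%:R.
  rewrite /mxtrace; under eq_bigr do rewrite mxE eqxx /= mulrb.
  rewrite -big_mkcond /= -(big_ord_widen _ (fun=> 1)) ?leq_subr //.
  by rewrite sumr_const card_ord.
have fx k : f_fun A k.+1 0 x = M%:R.
  rewrite f_funE; suff -> : words A x k 0 *m x = x by [].
  elim: k => [|k IHk]; rewrite words_rec /= !addr0; first by rewrite mul1mx.
  by rewrite mulmxDl -mulmxA IHk raddf0 mul0mx add0r.
have dx k : char_coef A x k 0 = idempotent_delta M k.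
  apply/eqP; rewrite -subr_eq0; apply/eqP.
  apply: (@euler_vanish M k (fun k => char_coef A x k 0 - idempotent_delta M k))
    (leqnn k) => [|{}k _].
    rewrite char_coef00 /idempotent_delta -horner_coef0 horner_exp !hornerE.
    by rewrite subr0 expr1n subrr.
  rewrite mulrBr sumrB mulrBr addrACA -opprD.
  rewrite -/(euler_op M k ((1 - 'X) ^+ M)) MS -[X in euler_op _ _ X]mulr1.
  rewrite euler_op_1subX derivC mulr0 coef0 subr0 -MS char_coef_f_fun.
  apply/eqP; rewrite addrC subr_eq0 mulr_sumr (reindex_inj rev_ord_inj) /=.
  apply/eqP; apply: eq_bigr => i _; rewrite big_ord1 fx mulrC subSS subn0.
  by congr (char_coef _ _ _ _ * _).
exists x; rewrite /level_det -/M (level_mx_ext _ _ (phi' := fun _ => M%:R) fx dx).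
by rewrite MS level_mx_det.
Qed.

End NonDegenerate.

(** * Gradients *)

Section Gradient.
Variables (K : numFieldType) (n : nat).
Implicit Types (A x v : 'M[K]_n) (f g : 'M[K]_n -> K).

(** Differentiability at x together with the value of the differential at v, so
  that both propagate through sums and products at once. *)
Definition has_diff x v f (c : K) := differentiable f x /\ 'd f x v = c.

Lemma has_diff_cst x v c : has_diff x v (fun _ => c) 0.
Proof.
split; first exact: differentiable_cst.
exact: (congr1 (fun h => h v) (diff_cst c x)).
Qed.

Lemma has_diff_coord x v i j : has_diff x v (fun y => y i j) (v i j).
Proof.
split; first exact: differentiable_coord.
have @f : {linear 'M[K]_n -> K}.
  by exists (fun N : 'M[K]_n => N i j); do 2![eexists]; do ?[constructor];
     rewrite ?mxE// => ? *; rewrite ?mxE//; move=> ?; rewrite !mxE.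
rewrite (_ : (fun _ => _) = f) // diff_lin //; exact: coord_continuous.
Qed.

Lemma has_diffD x v f g a b : has_diff x v f a -> has_diff x v g b ->
  has_diff x v (fun y => f y + g y) (a + b).
Proof.
move=> [df fE] [dg gE]; split; first exact: (differentiableD df dg).
by rewrite (diffD df dg) /= fE gE.
Qed.

Lemma has_diffM x v f g a b : has_diff x v f a -> has_diff x v g b ->
  has_diff x v (fun y => f y * g y) (a * g x + f x * b).
Proof.
move=> [df fE] [dg gE]; split; first exact: (differentiableM df dg).
have -> : 'd (fun y => f y * g y) x v = f x * 'd g x v + g x * 'd f x v.
  exact: (congr1 (fun h => h v) (diffM df dg)).
by rewrite fE gE addrC [X in X + _]mulrC.
Qed.

Lemma has_diff_sum x v m (F : 'I_m -> 'M[K]_n -> K) (a : 'I_m -> K) :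
  (forall i, has_diff x v (F i) (a i)) ->
  has_diff x v (fun y => \sum_i F i y) (\sum_i a i).
Proof.

move=> dF; elim: m => [|m IHm] in F a dF *.
  rewrite big_ord0; under eq_fun do rewrite big_ord0.
  exact: has_diff_cst.
rewrite big_ord_recr; under eq_fun do rewrite big_ord_recr.
by apply: has_diffD => //; apply: IHm.
Qed.

Fixpoint pencil_exp_diff A x v (m : nat) : 'M[{poly K}]_n :=
  if m is m'.+1 then
    map_mx polyC v *m linear_pencil A x ^+ m'
    + linear_pencil A x *m pencil_exp_diff A x v m'
  else 0.

Lemma has_diff_coef_pencil A x v m l i j :
  has_diff x v (fun y => coef_mx l (linear_pencil A y ^+ m) i j)
    (coef_mx l (pencil_exp_diff A x v m) i j).
Proof.
elim: m => [|m IHm] in l i j *.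
  rewrite coef_mx0 mxE; under eq_fun do rewrite coef_pencil_exp0.
  exact: has_diff_cst.
under eq_fun do rewrite coef_pencil_expS mxE.
rewrite /= coef_mxD coef_mx_mulC mulmxDl coef_mxD coef_mx_mulC -scalemxAl.
rewrite coef_mx_scaleX addrA mxE; apply: has_diffD.
  rewrite mxE ![(_ *m _) i j]mxE -big_split; under eq_fun do rewrite mxE.
  by apply: has_diff_sum => k; apply: has_diffM => //; apply: has_diff_coord.
case: l => [|l] /=.
  by under eq_fun do rewrite mxE; rewrite mxE; exact: has_diff_cst.
rewrite coef_mx_mulC mxE; under eq_fun do rewrite mxE.
apply: has_diff_sum => k; rewrite -[X in has_diff _ _ _ X]add0r.
rewrite -[X in has_diff _ _ _ (X + _)](mul0r (coef_mx l (linear_pencil A x ^+ m) k j)).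
by apply: has_diffM => //; exact: has_diff_cst.
Qed.

Lemma has_diff_h_fun A x v m l :
  has_diff x v (h_fun A m.+1 l) (\tr (coef_mx l (linear_pencil A x ^+ m) *m v)).
Proof.
have -> : h_fun A m.+1 l = (fun y => m.+1%:R^-1 *
    \sum_i coef_mx l (linear_pencil A y ^+ m.+1) i i).
  by apply/funext => y; rewrite h_funE.
have dE : \tr (coef_mx l (pencil_exp_diff A x v m.+1)) =
    m.+1%:R * \tr (coef_mx l (linear_pencil A x ^+ m) *m v).
  rewrite -coef_mx_mulCr -!coef_trace.
  rewrite (@trace_deriv_exp _ _ (linear_pencil A x) (map_mx polyC v)
    (pencil_exp_diff A x v)) // mulr_natl coefMn mulr_natl //.
have -> : \tr (coef_mx l (linear_pencil A x ^+ m) *m v) =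
    0 * (\sum_i coef_mx l (linear_pencil A x ^+ m.+1) i i) + m.+1%:R^-1 *
    \sum_i coef_mx l (pencil_exp_diff A x v m.+1) i i.
  by rewrite mul0r add0r -[\sum_i _ _ _]/(\tr _) dE mulKf // pnatr_eq0.
apply: has_diffM; first exact: has_diff_cst.
by apply: has_diff_sum => i; apply: has_diff_coef_pencil.
Qed.

Lemma gradient_of_has_diff f x (W : 'M[K]_n) :
  (forall v, has_diff x v f (\tr (W *m v))) -> gradient f x = W.
Proof.
move=> df; apply/matrixP => i j; rewrite mxE (proj2 (df _)).
rewrite /mxtrace (bigD1 i) //= mxE (bigD1 j) //= !mxE !eqxx mulr1.
rewrite big1 ?addr0 => [|k kj]; last by rewrite mxE (negPf kj) mulr0.
rewrite big1 ?addr0 // => k ki; rewrite mxE big1 // => h _.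
by rewrite mxE (negPf ki) andbF mulr0.
Qed.

(** The first variation of Tr (x + lambda A)^(m+1) along v is
  (m + 1) Tr ((x + lambda A)^m v). *)
Lemma gradient_h_fun A m l x :
  gradient (h_fun A m.+1 l) x = coef_mx l (linear_pencil A x ^+ m).
Proof. by apply: gradient_of_has_diff => v; apply: has_diff_h_fun. Qed.

Lemma gradient_f_fun A k l x :
  gradient (f_fun A k.+1 l) x =
  k.+1%:R *: coef_mx l (linear_pencil A x ^+ (k + l)).
Proof.
apply: gradient_of_has_diff => v.
have -> : f_fun A k.+1 l = (fun y => k.+1%:R * h_fun A (k + l).+1 l y).
  by apply/funext => y; rewrite f_fun_h_fun.
rewrite -scalemxAl mxtraceZ -[_ * _]add0r -(mul0r (h_fun A (k + l).+1 l x)).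
by apply: has_diffM; [exact: has_diff_cst|exact: has_diff_h_fun].
Qed.

End Gradient.

(** * Involution *)

Section Involution.
Variables (K : numFieldType) (n : nat).
Implicit Types (A x U V Y : 'M[K]_n).

(** The coadjoint form of the bracket: for fixed x, the pairing of U and V is
  the trace of U times this matrix, which is linear in V. *)
Definition pencil_dual A x (s1 s2 : K) V : 'M[K]_n :=
  s1 *: (V *m x - x *m V) + s2 *: (A *m V *m x - x *m V *m A).

Lemma lie_bracketNE A U V : lie_bracketN A U V = U *m A *m V - V *m A *m U.
Proof.
rewrite /lie_bracketN /lie_bracket /left_mul !mulmxBr !mulmxA.
by rewrite opprB addrA -[_ + (_ - _) + _]addrA subrK addrC -addrA addKr addrC.
Qed.

Lemma trace_pencil_bracket A x s1 s2 U V :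
  \tr (x *m pencil_bracket A s1 s2 U V) = \tr (U *m pencil_dual A x s1 s2 V).
Proof.
rewrite /pencil_bracket lie_bracketNE /lie_bracket /pencil_dual.
rewrite !mulmxDr -!scalemxAr !mxtraceD !mxtraceZ.
have trE (B C D : 'M[K]_n) : \tr (B *m (C *m D)) = \tr (C *m (D *m B)).
  by rewrite mxtrace_mulC mulmxA.
rewrite !mulmxBr !raddfB /= trE; congr (_ * (_ - _) + _ * (_ - _)).
- by rewrite trE trE.
- by rewrite -!mulmxA trE !mulmxA.
- by rewrite !mulmxA mxtrace_mulC !mulmxA.
Qed.

Lemma pencil_dual_antisym A x s1 s2 U V :
  \tr (U *m pencil_dual A x s1 s2 V) = - \tr (V *m pencil_dual A x s1 s2 U).
Proof.
rewrite -!trace_pencil_bracket -raddfN -mulmxN /pencil_bracket !lie_bracketNE.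
by rewrite opprD -!scalerN /lie_bracket !opprB.
Qed.

(** After bilinear expansion the terms cancel in pairs: each pair has equal traces
  by cyclicity, after reordering by U Y1 = Y1 U and V Y2 = Y2 V where needed. *)
Lemma commuting_pencil_dual Y1 Y2 (a1 a2 b1 b2 s1 s2 : K) U V :
    Y1 *m U = U *m Y1 -> Y2 *m V = V *m Y2 ->
  \tr (U *m pencil_dual (a1 *: Y1 + a2 *: Y2) (b1 *: Y1 + b2 *: Y2) s1 s2 V) = 0.
Proof.
move=> YU YV.
have t1 : \tr (U *m V *m Y1) = \tr (U *m Y1 *m V).
  by rewrite mxtrace_mulC mulmxA YU.
have t2 : \tr (U *m V *m Y2) = \tr (U *m Y2 *m V) by rewrite -!mulmxA YV.
have t3 : \tr (U *m Y2 *m V *m Y1) = \tr (U *m Y1 *m V *m Y2).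
  by rewrite mxtrace_mulC !mulmxA YU -!mulmxA YV.
have sl a (B C : 'M[K]_n) : (a *: B) *m C = a *: (B *m C) by rewrite scalemxAl.
have sr a (B C : 'M[K]_n) : B *m (a *: C) = a *: (B *m C) by rewrite scalemxAr.
have trB (B C : 'M[K]_n) : \tr (B - C) = \tr B - \tr C by rewrite raddfB.
rewrite /pencil_dual mulmxDr !sr !mulmxBr !(mulmxDl, mulmxDr, sl, sr) !mulmxA.
rewrite !(trB, mxtraceD, mxtraceZ) t1 t2 t3.
by ring.
Qed.

(** The characteristic is zero, so the points c0 + 1, c0 + 2, ... are distinct. *)
Lemma poly_cofinite_root (p : {poly K}) (c0 : K) :
  (forall c, c != c0 -> p.[c] = 0) -> p = 0.
Proof.
move=> p0; pose rs := [seq c0 + i.+1%:R | i <- iota 0 (size p)].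
apply: (@roots_geq_poly_eq0 _ p rs); last by rewrite size_map size_iota.
  apply/allP => _ /mapP[i _ ->]; apply/eqP; apply: p0.
  by rewrite -subr_eq0 addrC addKr pnatr_eq0.
rewrite map_inj_uniq ?iota_uniq // => i j /addrI /eqP.
by rewrite eqr_nat eqSS => /eqP.
Qed.

(** Passes from the values of a matrix polynomial to its coefficients. *)
Lemma coef_mx_trace0 (B : 'M[{poly K}]_n) V c0 :
    (forall c, c != c0 -> \tr (map_mx (horner_eval c) B *m V) = 0) ->
  forall l, \tr (coef_mx l B *m V) = 0.
Proof.
move=> B0 l; rewrite -coef_mx_mulCr -coef_trace.
rewrite (@poly_cofinite_root (\tr (B *m map_mx polyC V)) c0) ?coef0 // => c cc0.
rewrite -[RHS](B0 c cc0) -horner_evalE -trace_map_mx map_mxM; congr (\tr (_ *m _)).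
by apply/matrixP => i j; rewrite mxE [X in _ X = _]mxE; exact: hornerC.
Qed.

Lemma map_pencil_exp A x c m :
  map_mx (horner_eval c) (linear_pencil A x ^+ m) = (x + c *: A) ^+ m.
Proof.
elim: m => [|m IHm]; first by rewrite !expr0 map_mx1.
rewrite !exprS -![_ * _]/(_ *m _) map_mxM IHm; congr (_ *m _).
apply/matrixP => i j; rewrite mxE -[LHS]/((linear_pencil A x i j).[c]).
by rewrite !mxE !hornerE.
Qed.

(** Both gradients are coefficients of powers of x + lambda A; evaluate the first
  at c and the second at c' <> c.  Antisymmetry gives access to both
  arguments. *)
Lemma pencil_coef_involution A x s1 s2 a b l k :
  \tr (x *m pencil_bracket A s1 s2 (coef_mx l (linear_pencil A x ^+ a))
                                   (coef_mx k (linear_pencil A x ^+ b))) = 0.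
Proof.
(* Here no value of c has to be avoided; the excluded value 0 is arbitrary. *)
rewrite trace_pencil_bracket; apply: (@coef_mx_trace0 _ _ 0) => c _.
rewrite pencil_dual_antisym; apply/eqP; rewrite oppr_eq0; apply/eqP.
apply: (@coef_mx_trace0 _ _ c) => c' c'c; rewrite !map_pencil_exp.
set Y1 := x + c' *: A; set Y2 := x + c *: A.
have d0 : c' - c != 0 by rewrite subr_eq0.
have AE : A = (c' - c)^-1 *: Y1 + (- (c' - c)^-1) *: Y2.
  rewrite /Y1 /Y2 scaleNr -scalerBr opprD addrACA subrr add0r -scalerBl.
  by rewrite scalerA mulVf // scale1r.
have xE : x = (- (c' - c)^-1 * c) *: Y1 + ((c' - c)^-1 * c') *: Y2.
  rewrite /Y1 /Y2 !scalerDr !scalerA addrACA -!scalerDl.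
  have -> : - (c' - c)^-1 * c + (c' - c)^-1 * c' = 1.
    by rewrite mulNr addrC -mulrBr mulVf.
  have -> : - (c' - c)^-1 * c * c' + (c' - c)^-1 * c' * c = 0.
    by rewrite -!mulrA !mulNr (mulrC c') addNr.
  by rewrite scale1r scale0r addr0.
have commX (Y : 'M[K]_n) m : Y *m Y ^+ m = Y ^+ m *m Y.
  by rewrite -[LHS]/(Y * _) -[RHS]/(_ * Y) -exprS exprSr.
by rewrite {1}AE {1}xE; apply: commuting_pencil_dual.
Qed.

Lemma families_in_involution A :
  in_involution A (range (h_family A) `|` range (f_family A)).
Proof.
move=> s1 s2 f g Ff Fg x.
have grad h : (range (h_family A) `|` range (f_family A)) h ->
    exists c m l, gradient h x = c *: coef_mx l (linear_pencil A x ^+ m).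
  case=> -[[k l] _ <-].
    exists 1, k, l; rewrite scale1r; exact: gradient_h_fun.
  exists k.+1%:R, (k + l)%N, l; exact: gradient_f_fun.
rewrite /poisson_bracket.
have [a [m [l ->]]] := grad f Ff; have [b [m' [l' ->]]] := grad g Fg.
rewrite trace_pencil_bracket -scalemxAl mxtraceZ pencil_dual_antisym.
rewrite -scalemxAl mxtraceZ -trace_pencil_bracket pencil_coef_involution.
by rewrite !(mulr0, oppr0).
Qed.

End Involution.

(** * Holomorphic functions of a family *)

Section Holomorphic.
Variables (K : numFieldType) (n : nat) (I : finType) (f : I -> 'M[K]_n -> K).
Variable O : set 'M[K]_n.
Hypothesis openO : open O.

Definition generated_on (g : 'M[K]_n -> K) :=
  forall x, O x -> holomorphic_function_near f g x.

Lemma generated_on_member i : generated_on (f i).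
Proof.
move=> x Ox; exists setT, setT, (fun y => y 0 (enum_rank i)); split=> //.
- by split=> //; exact: openT.
- by split=> [|y _]; [exact: openT|exact: differentiable_coord].
- by move=> y _; rewrite mxE enum_rankK.
Qed.

Lemma generated_on_ring : ring_closed generated_on.
Proof.
split.
- move=> c x Ox; exists setT, setT, (fun _ => c); split=> //.
    by split=> //; exact: openT.
  by split=> [|y _]; [exact: openT|exact: differentiable_cst].
- move=> g h Pg Ph x Ox.
  have [U [V [F [[oU Ux] [oV dF] UV gF]]]] := Pg x Ox.
  have [U' [V' [F' [[oU' Ux'] [oV' dF'] UV' hF']]]] := Ph x Ox.
  exists (U `&` U'), (V `&` V'), (fun y => F y + F' y); split.
  + by split=> //; exact: openI.
  + split=> [|y [Vy V'y]]; first exact: openI.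
    exact: (differentiableD (dF y Vy) (dF' y V'y)).
  + by move=> y [Uy U'y]; split; [exact: UV|exact: UV'].
  + by move=> y [Uy U'y]; rewrite gF // hF'.
- move=> g h Pg Ph x Ox.
  have [U [V [F [[oU Ux] [oV dF] UV gF]]]] := Pg x Ox.
  have [U' [V' [F' [[oU' Ux'] [oV' dF'] UV' hF']]]] := Ph x Ox.
  exists (U `&` U'), (V `&` V'), (fun y => F y * F' y); split.
  + by split=> //; exact: openI.
  + split=> [|y [Vy V'y]]; first exact: openI.
    exact: (differentiableM (dF y Vy) (dF' y V'y)).
  + by move=> y [Uy U'y]; split; [exact: UV|exact: UV'].
  + by move=> y [Uy U'y]; rewrite gF // hF'.
Qed.

(** The quotient of the two local expressions is holomorphic where the
  denominator F does not vanish; F is non-zero at the values taken on O. *)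
Lemma generated_on_division : division_closed O generated_on.
Proof.
move=> g u g0 Pg Pgu x Ox.
have [U [V [F [[oU Ux] [oV dF] UV gF]]]] := Pg x Ox.
have [U' [V' [F' [[oU' Ux'] [oV' dF'] UV' guF']]]] := Pgu x Ox.
exists (U `&` U' `&` O), (V `&` V' `&` [set y | V y /\ F y != 0]),
  (fun y => (F y)^-1 * F' y); split.
- by split=> //; do ?apply: openI.
- split=> [|y [[Vy V'y] [_ Fy]]]; last first.
    exact: (differentiableM (differentiableV (dF y Vy) Fy) (dF' y V'y)).
  apply: openI; first exact: openI.
  rewrite openE => y [Vy Fy]; rewrite /interior.
  have Fc : {for y, continuous F} by exact/differentiable_continuous/dF.
  have : \forall z \near y, V z by exact: open_nbhs_nbhs.
  have : \forall z \near y, F z != 0.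
    exact: (cvgr_neq0 (F y) Fc Fy).
  by apply: filterS2.
- move=> y [[Uy U'y] Oy]; split; first by split; [exact: UV|exact: UV'].
  by split; [exact: UV|rewrite -gF ?g0].
- move=> y [[Uy U'y] Oy].
  by rewrite -guF' // -gF // mulKf // g0.
Qed.

End Holomorphic.

(** * Open dense sets *)

Section Density.
Variables (K : numFieldType) (n : nat).
Implicit Types (x y : 'M[K]_n) (g : 'M[K]_n -> K).

(** A substitute for polynomiality that suffices for density. *)
Definition polynomial_on_lines g :=
  forall x y, exists p : {poly K}, forall t, g (x + t *: y) = p.[t].

Lemma polynomial_on_lines_ring : ring_closed polynomial_on_lines.
Proof.
split.
- by move=> c x y; exists c%:P => t; rewrite hornerC.
- move=> g h Pg Ph x y; have [p pE] := Pg x y; have [q qE] := Ph x y.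
  by exists (p + q) => t; rewrite hornerD pE qE.
- move=> g h Pg Ph x y; have [p pE] := Pg x y; have [q qE] := Ph x y.
  by exists (p * q) => t; rewrite hornerM pE qE.
Qed.

Lemma polynomial_on_lines_coord i j : polynomial_on_lines (fun x => x i j).
Proof.
by move=> x y; exists ((x i j)%:P + 'X * (y i j)%:P) => t; rewrite !hornerE !mxE.
Qed.

Lemma differentiable_ring :
  ring_closed (fun g => forall x, differentiable g x).
Proof.
split=> [c x|g h dg dh x|g h dg dh x]; first exact: differentiable_cst.
  exact: (differentiableD (dg x) (dh x)).
exact: (differentiableM (dg x) (dh x)).
Qed.

Lemma open_neq0 g : (forall x, differentiable g x) -> open [set x | g x != 0].
Proof.
move=> dg; rewrite openE => x gx; rewrite /interior.
have gc : {for x, continuous g} by exact/differentiable_continuous.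
exact: (cvgr_neq0 (g x) gc gx).
Qed.

(** On the line through x0 and a point x1 where g is non-zero, g has finitely many
  zeros, and the points e / 2, e / 3, ... of the parameter are infinitely many
  and all within e of the parameter 0 of x0. *)
Lemma dense_neq0 g x1 : polynomial_on_lines g -> g x1 != 0 ->
  dense [set x | g x != 0].
Proof.
move=> Pg gx1 U [x0 Ux0] oU; have [p pE] := Pg x0 (x1 - x0).
have p0 : p != 0.
  apply: contra_neq gx1 => p0; have := pE 1.
  by rewrite scale1r addrC subrK => ->; rewrite p0 horner0.
have cl : {for 0, continuous (fun t : K => x0 + t *: (x1 - x0))}.
  apply: continuousD; first exact: cst_continuous.
  exact: scalel_continuous.
have /nbhs_ballP[e /= e0 eU] : \forall t \near (0 : K), U (x0 + t *: (x1 - x0)).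
  have nU : nbhs (x0 + 0 *: (x1 - x0)) U.
    by rewrite scale0r addr0; apply: open_nbhs_nbhs.
  exact: (cl U nU).
pose t (i : nat) : K := e / i.+2%:R.
have [i pti] : exists i, p.[t i] != 0.
  apply: contrapT => noroot; move/negP: p0; apply; apply/eqP.
  apply: (@roots_geq_poly_eq0 _ p [seq t i | i <- iota 0 (size p)]).
  - apply/allP => _ /mapP[i _ ->]; apply: contrapT => /negP nr.
    by apply: noroot; exists i.
  - rewrite map_inj_uniq ?iota_uniq // => i j /(mulfI (lt0r_neq0 e0))/invr_inj/eqP.
    by rewrite eqr_nat !eqSS => /eqP.
  - by rewrite size_map size_iota.
exists (x0 + t i *: (x1 - x0)); split; last by rewrite /= pE.
apply: eU; rewrite /ball /= sub0r normrN /t ger0_norm; last first.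
  by rewrite divr_ge0 ?ler0n // ltW.
by rewrite ltr_pdivrMr ?ltr0n // ltr_pMr // ltr1n.
Qed.

End Density.

(** * Functional generation of each family by the other *)

Section Generate.
Variables (K : numFieldType) (n : nat) (A : 'M[K]_n).

Definition nondegenerate : set 'M[K]_n :=
  [set x | forall l, (l.+1 < n)%N -> level_det A l x != 0].

Lemma closed_level_det (P : ('M[K]_n -> K) -> Prop) l : ring_closed P ->
  (forall i j, P (fun x => x i j)) -> P (level_det A l).
Proof.
move=> Pring Pcoord; apply: (closed_det Pring).
apply: (@closed_level_mx K n A _ _ P Pring) => i; first exact: closed_f_fun.
apply: (closed_char_coef Pring) => a b _ _; exact: closed_f_fun.
Qed.

Lemma nondegenerate_open_dense : open nondegenerate /\ dense nondegenerate.
Proof.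
pose D N := [set x : 'M[K]_n | forall l, (l < N)%N -> (l.+1 < n)%N ->
  level_det A l x != 0].
have -> : nondegenerate = D n.
  apply/seteqP; split=> x /= nx l; first by move=> _; exact: nx.
  by move=> ltn; apply: nx => //; apply: ltnW.
have step l : (l.+1 < n)%N ->
    open [set x : 'M[K]_n | level_det A l x != 0] /\
    dense [set x : 'M[K]_n | level_det A l x != 0].
  move=> ltln; split.
    apply: open_neq0; apply: (closed_level_det l (@differentiable_ring K n)).
    by move=> i j x; exact: differentiable_coord.
  have [x1 gx1] := level_det_neq0 A ltln.
  apply: dense_neq0 gx1.
  apply: (closed_level_det l (@polynomial_on_lines_ring K n)).
  exact: polynomial_on_lines_coord.
(* D N imposes the first N conditions only: induction on their number. *)
suff H N : open (D N) /\ dense (D N) by exact: H.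
elim: N => [|N [oN dN]].
  have -> : D 0%N = setT by apply/seteqP; split.
  split; first exact: openT.
  by move=> U [x Ux] _; exists x.
have [ltN|geN] := ltnP N.+1 n; last first.
  have -> // : D N.+1 = D N.
  apply/seteqP; split=> x /= dx l ltl ltln; apply: dx => //.
    exact: ltnW.
  by rewrite ltn_neqAle; move: ltl ltln; lia.
have -> : D N.+1 = D N `&` [set x | level_det A N x != 0].
  apply/seteqP; split=> x /= => [dx|[dx dxN] l].
    by split=> [l ltl|]; apply: dx => //; apply: ltnW.
  by rewrite ltnS leq_eqVlt => /orP[/eqP-> //|]; exact: dx.
by have [oL dL] := step N ltN; split; [exact: openI|exact: denseI].
Qed.

Lemma kl_index_exists k l (ltk : (k < n)%N) (lel : (l < k.+1)%N) :
  exists i : @kl_index n, (forall x, h_family A i x = h_fun A k.+1 l x) /\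
                          (forall x, f_family A i x = f_fun A k.+1 l x).
Proof.
by exists (@Tagged _ (Ordinal ltk) (fun k : 'I_n => 'I_k.+1) (Ordinal lel)).
Qed.

Lemma families_generate_same :
  functionally_generate_same (h_family A) (f_family A).
Proof.
have [oN dN] := nondegenerate_open_dense.
exists nondegenerate; split=> // x Nx; split=> [[[k ltk] [l ltl]]|[[k ltk] [l ltl]]].
  pose P := generated_on (h_family A) nondegenerate.
  have Pring : ring_closed P by exact: generated_on_ring.
  suff : P (f_fun A k.+1 l) by exact.
  apply: (f_fun_of_triangle Pring) => {ltk ltl} {}k {}l lekl.
  have ltk : (k + l < n)%N by [].
  have ltl : (l < (k + l).+1)%N by rewrite ltnS leq_addl.
  have [i [hi _]] := kl_index_exists ltk ltl.
  have -> : f_fun A k.+1 l = (fun y => k.+1%:R * h_family A i y).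
    by apply/funext => y; rewrite hi f_fun_h_fun.
  apply: (closedM Pring); first exact: (closed_cst Pring).
  exact: generated_on_member.
pose P := generated_on (f_family A) nondegenerate.
have Pring : ring_closed P by exact: generated_on_ring.
suff : P (h_fun A k.+1 l) by exact.
have -> : h_fun A k.+1 l = (fun y => (k - l).+1%:R^-1 * f_fun A (k - l).+1 l y).
  apply/funext => y; rewrite f_fun_h_fun mulKf ?pnatr_eq0 //.
  by rewrite addSn subnK.
apply: (closedM Pring); first exact: (closed_cst Pring).
apply: (f_fun_of_f_family Pring (generated_on_division _)) => //.
  by move=> l' y ltln Ny; apply: Ny.
move=> {ltk ltl} {}k {}l /andP[lel ltk].
have [i [_ fi]] := kl_index_exists ltk (lel : (l < k.+1)%N).
have -> : f_fun A k.+1 l = f_family A i by apply/funext => y; rewrite fi.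
exact: generated_on_member.
Qed.

End Generate.

(** * The theorem *)

Theorem mainTheorem5 (R : realType) (n : nat)
    (lam : 'I_n -> complexField R) (lam_inj : injective lam) :
  let A : 'M[complexField R]_n := diag_mx (\row_i lam i) in
  functionally_generate_same (h_family A) (f_family A) /\
  in_involution A (range (h_family A) `|` range (f_family A)).
Proof.
by split; [exact: families_generate_same|exact: families_in_involution].
Qed.
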